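(* Let $f:\mathbb{R}\times\mathbb{R}^n\to\mathbb{R}^n$ satisfy, for some $L_f>0$, $$\|f(t_1,x_1)-f(t_2,x_2)\|\le L_f|t_1-t_2|+L_f\|x_1-x_2\|\quad\text{for all } t_1,t_2\in\mathbb{R},\ x_1,x_2\in\mathbb{R}^n.$$ Assume that, for every $t\in\mathbb{R}$, the set $C(t)\subset\mathbb{R}^n$ is nonempty, closed and convex, that for some $L_C>0$ one has $d_H(C(t_1),C(t_2))\le L_C|t_1-t_2|$ for all $t_1,t_2\in\mathbb{R}$, and that $C$ is globally bounded, i.e. there is $M>0$ such that $\|c\|\le M$ for all $c\in C(t)$ and all $t\in\mathbb{R}$. If there is a constant $\alpha>0$ such that $$\langle f(t,x_1)-f(t,x_2),x_1-x_2\rangle\ge\alpha\|x_1-x_2\|^2\quad\text{for all } t\in\mathbb{R},\ x_1,x_2\in\mathbb{R}^n,$$ then the sweeping process $$-\dot x(t)\in N_{C(t)}(x(t))+f(t,x(t))$$ is incrementally stable and admits exactly one absolutely continuous solution $x_0$ defined on the entire $\mathbb{R}$. Moreover, $x_0$ is globally exponentially stable.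
   Context: For a closed convex set $C\subset\mathbb{R}^n$, the outward normal cone is $N_C(x)=\{\xi\in\mathbb{R}^n:\langle\xi,c-x\rangle\le 0\text{ for all }c\in C\}$ if $x\in C$ and $N_C(x)=\emptyset$ if $x\notin C$. The Hausdorff distance between closed sets is $d_H(C_1,C_2)=\max\{\sup_{x\in C_2}\mathrm{dist}(x,C_1),\sup_{x\in C_1}\mathrm{dist}(x,C_2)\}$ with $\mathrm{dist}(x,C)=\inf\{\|x-c\|:c\in C\}$. A solution of the sweeping process on an interval $I\subseteq\mathbb{R}$ is a function $x:I\to\mathbb{R}^n$, absolutely continuous on every compact subinterval of $I$, with $x(t)\in C(t)$ for all $t\in I$, that satisfies the inclusion for almost every $t\in I$. Incremental stability means: there is a function $\beta:[0,\infty)\times[0,\infty)\to[0,\infty)$, with $\beta(\cdot,s)$ continuous, strictly increasing and $\beta(0,s)=0$ for each $s$, and $\beta(r,\cdot)$ nonincreasing with $\beta(r,s)\to0$ as $s\to\infty$ for each $r$, such that any two solutions $x_1,x_2$ on $[t_0,\infty)$ (any $t_0\in\mathbb{R}$) satisfy $\|x_1(t)-x_2(t)\|\le\beta(\|x_1(t_0)-x_2(t_0)\|,t-t_0)$ for all $t\ge t_0$. Global exponential stability of $x_0$ means: there are $K,\lambda>0$ such that for every $\tau\in\mathbb{R}$ and every solution $v$ on $[\tau,\infty)$ one has $\|v(t)-x_0(t)\|\le Ke^{-\lambda(t-\tau)}\|v(\tau)-x_0(\tau)\|$ for all $t\ge\tau$. *)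

(* Defs.v *)
From HB Require Import structures.
From mathcomp Require Import all_boot all_order all_algebra.
From mathcomp Require Import all_classical all_reals all_analysis.

Set Implicit Arguments.
Unset Strict Implicit.
Unset Printing Implicit Defensive.

Import Order.TTheory GRing.Theory Num.Theory.
Import numFieldNormedType.Exports.

Local Open Scope classical_set_scope.
Local Open Scope ring_scope.

Section euclidean.
Context {R : realType} {n : nat}.
Implicit Types (u v x xi : 'rV[R]_n) (A B : set 'rV[R]_n).

Definition dotv u v : R := (u *m v^T) 0 0.

(* The library norm `|u| on 'rV[R]_n is the sup norm; it is used below only
   through the topology, which is the Euclidean one. *)
Definition enorm u : R := Num.sqrt (dotv u u).

Definition normal_cone A x : set 'rV[R]_n :=
  [set xi | A x /\ forall c, A c -> dotv xi (c - x) <= 0].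

Definition edist_set x A : \bar R :=
  ereal_inf [set (enorm (x - c))%:E | c in A].

Definition hausdorff_dist A B : \bar R :=
  Order.max (ereal_sup [set edist_set x A | x in B])
            (ereal_sup [set edist_set x B | x in A]).

Definition abs_continuous (a b : R) (x : R -> 'rV[R]_n) : Prop :=
  forall e : R, 0 < e -> exists2 d : R, 0 < d &
    forall (m : nat) (u v : 'I_m -> R),
      (forall k, [/\ a <= u k, u k < v k & v k <= b]) ->
      trivIset setT (fun k => `]u k, v k[%classic) ->
      \sum_(k < m) (v k - u k) < d ->
      \sum_(k < m) enorm (x (v k) - x (u k)) < e.

End euclidean.

Section sweeping.
Context {R : realType} {n : nat}.
Variables (f : R -> 'rV[R]_n -> 'rV[R]_n) (C : R -> set 'rV[R]_n).

(* A function on I is represented by a total function on R whose values outside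
   I are irrelevant: the two-sided derivative sees them only at the (at most
   two) endpoints of I, a null set. *)
Definition sweeping_solution (I : interval R) (x : R -> 'rV[R]_n) : Prop :=
  [/\ forall a b, a <= b -> `[a, b] `<=` [set` I] -> abs_continuous a b x,
      forall t, t \in I -> C t (x t) &
      {ae lebesgue_measure, forall t : R, t \in I -> derivable x t 1 /\
        exists2 xi, normal_cone (C t) (x t) xi &
                    - 'D_1 x t = xi + f t (x t)}].

Definition incrementally_stable : Prop :=
  exists beta : R -> R -> R,
  [/\ forall r s, 0 <= r -> 0 <= s -> 0 <= beta r s,
      forall s, 0 <= s ->
        [/\ {within `[0, +oo[, continuous (beta^~ s)},
            {in `[0, +oo[ &, {homo beta^~ s : r1 r2 / r1 < r2}} &
            beta 0 s = 0],
      forall r, 0 <= r ->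
        {in `[0, +oo[ &, {homo beta r : s1 s2 /~ s1 <= s2}} /\
        beta r s @[s --> +oo] --> 0 &
      forall (t0 : R) (x1 x2 : R -> 'rV[R]_n),
        sweeping_solution `[t0, +oo[ x1 -> sweeping_solution `[t0, +oo[ x2 ->
        forall t, t0 <= t ->
          enorm (x1 t - x2 t) <= beta (enorm (x1 t0 - x2 t0)) (t - t0)].

Definition globally_exponentially_stable (x0 : R -> 'rV[R]_n) : Prop :=
  exists K lambda : R, [/\ 0 < K, 0 < lambda &
    forall (tau : R) (v : R -> 'rV[R]_n),
      sweeping_solution `[tau, +oo[ v ->
      forall t, tau <= t ->
        enorm (v t - x0 t)
          <= K * expR (- lambda * (t - tau)) * enorm (v tau - x0 tau)].

End sweeping.

(* Main.v *)
Require Import Defs.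
From HB Require Import structures.
From mathcomp Require Import all_boot all_order all_algebra.
From mathcomp Require Import all_classical all_reals all_analysis.
From mathcomp Require Import ring lra.

(* Contraction: along two solutions, monotonicity of the normal cone and of [f]
   gives [(|x1 - x2|^2 e^{2 alpha t})' <= 0] almost everywhere, so by absolute
   continuity this quantity is nonincreasing.  This yields both stability claims with
   [beta(r, s) = e^{- alpha s} r], and uniqueness on the whole line because
   solutions stay in the ball of radius [M].

   Existence: the catching-up scheme [z_{k+1} = proj (z_k - h f(s_k, z_k))] on
   [C(s_{k+1})] satisfies, for [c] in [C(t)] and grid times [s_i <= s_j] within [d]
   of [t], the inequality [<z_i - z_j - (s_j - s_i) f(s_i, z_i), c - z_i> <= B d^2].
   This inequality, membership and the local Lipschitz bound pass to pointwise
   limits, so no Cauchy estimate is needed, and at a point of differentiability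
   dividing by [d] gives the inclusion.  Differentiability almost everywhere of
   Lipschitz functions comes from Radon-Nikodym and Lebesgue differentiation. *)

Set Implicit Arguments.
Unset Strict Implicit.
Unset Printing Implicit Defensive.

Import Order.TTheory GRing.Theory Num.Theory.
Import numFieldNormedType.Exports.

Local Open Scope classical_set_scope.
Local Open Scope ring_scope.

(** * Euclidean inner product, norm and balls on row vectors *)

Section euclidean_space.
Context {R : realType} {n : nat}.
Implicit Types (u v w : 'rV[R]_n) (k : R).

Lemma dotvE u v : dotv u v = \sum_i u 0 i * v 0 i.
Proof. by rewrite /dotv mxE; apply: eq_bigr => i _; rewrite mxE. Qed.

Lemma dotvC u v : dotv u v = dotv v u.
Proof. by rewrite !dotvE; apply: eq_bigr => i _; rewrite mulrC. Qed.

Lemma dotvDl u v w : dotv (u + v) w = dotv u w + dotv v w.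
Proof. by rewrite /dotv mulmxDl mxE. Qed.

Lemma dotvNl u w : dotv (- u) w = - dotv u w.
Proof. by rewrite /dotv mulNmx mxE. Qed.

Lemma dotvBl u v w : dotv (u - v) w = dotv u w - dotv v w.
Proof. by rewrite dotvDl dotvNl. Qed.

Lemma dotvZl k u w : dotv (k *: u) w = k * dotv u w.
Proof. by rewrite /dotv -scalemxAl mxE. Qed.

Lemma dotvDr u v w : dotv w (u + v) = dotv w u + dotv w v.
Proof. by rewrite dotvC dotvDl !(dotvC w). Qed.

Lemma dotvNr u w : dotv w (- u) = - dotv w u.
Proof. by rewrite dotvC dotvNl dotvC. Qed.

Lemma dotvBr u v w : dotv w (u - v) = dotv w u - dotv w v.
Proof. by rewrite dotvDr dotvNr. Qed.

Lemma dotvZr k u w : dotv w (k *: u) = k * dotv w u.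
Proof. by rewrite dotvC dotvZl dotvC. Qed.

Lemma dotvBD u v : dotv (u - v) (u + v) = dotv u u - dotv v v.
Proof. by rewrite dotvBl !dotvDr (dotvC v u); ring. Qed.

Lemma dotvBB u v : dotv (u - v) (u - v) = dotv u u - 2 * dotv u v + dotv v v.
Proof. by rewrite !(dotvBl, dotvBr) (dotvC v u); ring. Qed.

Lemma dotv_ge0 u : 0 <= dotv u u.
Proof. by rewrite dotvE sumr_ge0// => i _; rewrite -expr2 sqr_ge0. Qed.

Lemma enorm_ge0 u : 0 <= enorm u.
Proof. exact: sqrtr_ge0. Qed.

Lemma enorm_sqr u : enorm u ^+ 2 = dotv u u.
Proof. by rewrite sqr_sqrtr// dotv_ge0. Qed.

Lemma sqr_coord_le_dotv u i : u 0 i ^+ 2 <= dotv u u.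
Proof.
rewrite dotvE (bigD1 i)//= -expr2 lerDl.
by apply: sumr_ge0 => j _; rewrite -expr2 sqr_ge0.
Qed.

Lemma normr_coord_le_enorm u i : `|u 0 i| <= enorm u.
Proof. by rewrite -sqrtr_sqr ler_sqrt ?dotv_ge0// sqr_coord_le_dotv. Qed.

(** The library norm is the sup norm; this comparison turns Euclidean estimates into convergence and
    boundedness in the library topology. *)
Lemma normr_le_enorm u : `|u| <= enorm u.
Proof.
rewrite [leLHS]/Num.Def.normr/= mx_normrE bigmax_le ?enorm_ge0// => -[i j] _ /=.
by rewrite ord1 normr_coord_le_enorm.
Qed.

Lemma enorm0_eq0 u : enorm u = 0 -> u = 0.
Proof. by move=> u0; apply/eqP; rewrite -normr_le0 -u0 normr_le_enorm. Qed.

Lemma enorm0 : enorm (0 : 'rV[R]_n) = 0.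
Proof. by rewrite /enorm -(scale0r 0) dotvZl mul0r sqrtr0. Qed.

(** Cauchy-Schwarz, read off from the nonnegative square of [enorm v ^+ 2 *: u - dotv u v *: v], in
    which [enorm v ^+ 2] can be cancelled once [v] is nonzero. *)
Lemma dotv_le u v : dotv u v <= enorm u * enorm v.
Proof.
have [v0|v0] := eqVneq (enorm v) 0.
  by rewrite (enorm0_eq0 v0) -(scale0r 0) dotvZr mul0r scale0r enorm0 mulr0.
have v_gt0 : 0 < enorm v by rewrite lt_neqAle eq_sym v0 enorm_ge0.
have := dotv_ge0 (enorm v ^+ 2 *: u - dotv u v *: v).
rewrite !(dotvBl, dotvBr, dotvZl, dotvZr) (dotvC v u) -!enorm_sqr => h.
have {}h : 0 <= enorm v ^+ 2 * ((enorm u * enorm v) ^+ 2 - dotv u v ^+ 2) by lra.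
rewrite pmulr_rge0 ?exprn_gt0// subr_ge0 in h.
by rewrite (le_trans (ler_norm _))// -ler_sqr ?nnegrE ?mulr_ge0 ?enorm_ge0//
  real_normK ?num_real.
Qed.

Lemma enormN u : enorm (- u) = enorm u.
Proof. by rewrite /enorm dotvNl dotvNr opprK. Qed.

Lemma enormB u v : enorm (u - v) = enorm (v - u).
Proof. by rewrite -enormN opprB. Qed.

Lemma enormZ k u : enorm (k *: u) = `|k| * enorm u.
Proof.
by rewrite /enorm dotvZl dotvZr mulrA -expr2 sqrtrM ?sqr_ge0// sqrtr_sqr.
Qed.

Lemma enormD u v : enorm (u + v) <= enorm u + enorm v.
Proof.
rewrite -ler_sqr ?nnegrE ?addr_ge0 ?enorm_ge0// enorm_sqr.
rewrite dotvDl !dotvDr (dotvC v u) sqrrD -!enorm_sqr.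
have := dotv_le u v; lra.
Qed.

Lemma enorm_triangle u v w : enorm (u - w) <= enorm (u - v) + enorm (v - w).
Proof. by rewrite (le_trans _ (enormD _ _))// subrKA. Qed.

Lemma cvg_dotv {T : Type} (F : set_system T) {FF : Filter F}
    (a b : T -> 'rV[R]_n) (u v : 'rV[R]_n) :
  a @ F --> u -> b @ F --> v -> dotv (a t) (b t) @[t --> F] --> dotv u v.
Proof.
move=> au bv; rewrite dotvE; under eq_fun do rewrite dotvE.
apply: cvg_big => [|i _]; [by move=> ?; exact: add_continuous|apply: cvgM].
- exact: (cvg_comp _ _ au (@coord_continuous _ _ _ 0 i u)).
- exact: (cvg_comp _ _ bv (@coord_continuous _ _ _ 0 i v)).
Qed.

Lemma cvg_enorm {T : Type} (F : set_system T) {FF : Filter F}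
    (a : T -> 'rV[R]_n) u :
  a @ F --> u -> enorm (a t) @[t --> F] --> enorm u.
Proof.
move=> au; exact: (cvg_comp _ _ (cvg_dotv au au) (@sqrt_continuous R _)).
Qed.

Lemma enorm_continuous : continuous (@enorm R n).
Proof. by move=> u; exact: (@cvg_enorm _ (nbhs u) _ id u). Qed.

Lemma enorm_cvg0 {T : Type} (F : set_system T) {FF : Filter F}
    (a : T -> 'rV[R]_n) u :
  enorm (a t - u) @[t --> F] --> (0 : R) -> a @ F --> u.
Proof.
move=> au; apply/cvgrPdist_le => e e0.
move/cvgrPdist_le : au => /(_ _ e0); apply: filterS => t /=.
rewrite sub0r normrN ger0_norm ?enorm_ge0//; apply: le_trans.
by rewrite distrC normr_le_enorm.
Qed.

Lemma compact_enorm_ball (r : R) : compact [set u : 'rV[R]_n | enorm u <= r].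
Proof.
apply: bounded_closed_compact.
  exists r; split; first exact: num_real.
  by move=> s rs u /= ur; rewrite (le_trans (normr_le_enorm u))// (le_trans ur)// ltW.
apply: (@closed_comp _ _ (@enorm R n) [set t | t <= r]); last exact: closed_le.
by move=> u _; exact: enorm_continuous.
Qed.

End euclidean_space.

(** * Monotonicity from the sign of the derivative almost everywhere *)

(** Let [c] be the supremum of the points of [[a, b]] where [P] holds. Some such point lies within
    [r] to the left of [c], and the step hypothesis carries [P] from it to [b] or to a point beyond
    [c]. *)
Lemma real_induction (R : realType) (P : R -> Prop) (a b : R) : a <= b -> P a ->
  (forall c, a <= c <= b -> exists2 r, 0 < r &
    forall u v, a <= u -> c - r < u -> u <= c -> c <= v -> v < c + r -> v <= b ->
      P u -> P v) ->
  P b.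
Proof.
move=> ab Pa step.
pose S := [set t | [/\ a <= t, t <= b & P t]].
have Sa : S a by split.
have supS : has_sup S by split; [exists a|exists b => t []].
pose c := sup S.
have ac : a <= c by exact: (sup_upper_bound supS).
have cb : c <= b by apply: sup_le_ub; [exists a|move=> t []].
have [|r r0 stepc] := step c; first by rewrite ac.
have [u [au ub Pu] cu] := sup_adherent r0 supS.
have uc : u <= c by exact: (sup_upper_bound supS).
have [cltb|bc] := ltP c b; last first.
  by apply: (stepc u) => //; rewrite ?ltrDl// (le_lt_trans bc)// ltrDl.
pose v := Num.min b (c + r / 2).
have cv : c < v by rewrite lt_min cltb ltrDl divr_gt0.
have vb : v <= b by rewrite ge_min lexx.
suff : S v by move/(sup_upper_bound supS); rewrite leNgt cv.
split => //; first by rewrite (le_trans ac)// ltW.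
apply: (stepc u) => //; first exact: ltW.
by rewrite gt_min ltrD2l gtr_pMr// invf_lt1 ?ltr1n// orbT.
Qed.

(** An increment over an interval straddling [t] splits at [t] into two pieces, each controlled by
    difference quotients below [e]. This is the local step for [real_induction] at a good point. *)
Lemma derive_le0_increment (R : realType) (phi : R -> R) (t e : R) :
  derivable phi t 1 -> 'D_1 phi t <= 0 -> 0 < e ->
  exists2 r, 0 < r & forall u v, t - r < u -> u <= t -> t <= v -> v < t + r ->
    phi v - phi u <= e * (v - u).
Proof.
move=> dphi Dphi e0.
have /cvgr_lt/(_ e) := dphi => /(_ (le_lt_trans Dphi e0)).
move=> /nbhs_ballP[r /= r0 rq]; exists r => // u v tu ut tv vt.
have incr h : `|h| < r -> h != 0 -> h^-1 * (phi (h + t) - phi t) < e.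
  move=> hr h0; have := rq h; rewrite -ball_normE /= sub0r normrN scaler1.
  exact.
have tv' : phi v - phi t <= e * (v - t).
  have [<-|tv0] := eqVneq t v; first by rewrite !subrr mulr0.
  have vt0 : 0 < v - t by rewrite subr_gt0 lt_neqAle tv0.
  have := incr (v - t); rewrite gtr0_norm// subrK ltrBlDl => /(_ vt).
  by rewrite gt_eqF// => /(_ isT); rewrite mulrC ltr_pdivrMr// => /ltW.
have ut' : phi t - phi u <= e * (t - u).
  have [->|tu0] := eqVneq u t; first by rewrite !subrr mulr0.
  have ut0 : 0 < t - u by rewrite subr_gt0 lt_neqAle tu0.
  have := incr (u - t); rewrite distrC gtr0_norm// subrK ltrBlDl -ltrBlDr => /(_ tu).
  rewrite subr_eq0 => /(_ tu0); rewrite -opprB invrN mulNr -mulrN opprB.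
  by rewrite mulrC ltr_pdivrMr// => /ltW.
lra.
Qed.

(* The null set where the derivative is uncontrolled is covered by an open set
   [U] of small measure; moving right from [a], an increment of [phi] is either
   controlled by the derivative or charged to an interval contained in [U], and
   absolute continuity makes the total of the latter increments small. *)
Lemma ac_derive_le0_le (R : realType) (phi : R -> R) (a b : R) : a <= b ->
  (forall e, 0 < e -> exists2 d, 0 < d &
    forall (m : nat) (u v : 'I_m -> R),
      (forall k, [/\ a <= u k, u k < v k & v k <= b]) ->
      trivIset setT (fun k => `]u k, v k[%classic) ->
      \sum_(k < m) (v k - u k) < d ->
      \sum_(k < m) (phi (v k) - phi (u k)) < e) ->
  {ae lebesgue_measure, forall t : R, t \in `[a, b] ->
    derivable phi t 1 /\ 'D_1 phi t <= 0} ->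
  phi b <= phi a.
Proof.
move=> ab phi_ac [N [mN N0 badN]].
suff small e : 0 < e -> phi b - phi a <= e * (b - a) + e.
  rewrite leNgt -subr_gt0; apply/negP => gap.
  (* With this value for [e], the bound [e * (b - a) + e] is half of the positive gap; the summand 1
     keeps the denominator positive when [a = b]. *)
  have h : 0 < (phi b - phi a) / (2 * (b - a + 1)).
    by rewrite divr_gt0// mulr_gt0// ltr_wpDl// subr_ge0.
  have := small _ h; rewrite -[X in _ <= _ + X]mulr1 -mulrDr.
  have -> : (phi b - phi a) / (2 * (b - a + 1)) * (b - a + 1) = (phi b - phi a) / 2.
    by field; rewrite gt_eqF// ltr_wpDl// subr_ge0.
  lra.
move=> e0; have [d d0 acd] := phi_ac _ e0.
have [|U [oU NU mUN]] := lebesgue_regularity_outer mN _ d0.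
  by rewrite [X in (X < _)%E]N0 ltry.
have mU : measurable U by exact: measurable_realfun.open_measurable.
have Ud : (lebesgue_measure U < d%:E)%E.
  apply: le_lt_trans mUN.
  rewrite -[X in (lebesgue_measure X <= _)%E](setDUK NU).
  rewrite (le_trans (measureU2 _ _ _))//; first exact: measurableD.
  by rewrite [X in (X + _)%E]N0 add0e.
(* [s] records the charged intervals, the rightmost first, so that [pairwise] expresses
   disjointness; their increments of [phi] are added to the controlled part. *)
pose P t := exists s : seq (R * R), [/\
  forall p, p \in s -> [/\ a <= p.1, p.1 < p.2, p.2 <= t & `]p.1, p.2[ `<=` U],
  pairwise (fun p q => q.2 <= p.1) s &
  phi t - phi a <= e * (t - a) + \sum_(p <- s) (phi p.2 - phi p.1)].
have Pb : P b.
  apply: (@real_induction _ P a b) => //.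
    by exists [::]; split => //; rewrite big_nil !subrr mulr0 addr0.
  move=> c /andP[ac cb].
  have [Uc|Uc] := pselect (U c).
    have /nbhs_ballP[r /= r0 rU] : nbhs c U by exact: open_nbhs_nbhs.
    exists r => // u v au cu uc cv vr vb [s [sI sP sS]].
    have [uv|uv] := eqVneq u v.
      exists s; split => //.
        by move=> p /sI[? ? pu ?]; split => //; rewrite -uv.
      by rewrite -uv.
    have ltuv : u < v by rewrite lt_neqAle uv (le_trans uc).
    exists ((u, v) :: s); split.
    - move=> p; rewrite inE => /orP[/eqP ->/=|/sI[? ? pu ?]]; last first.
        by split => //; rewrite (le_trans pu)// ltW.
      split => // x /=; rewrite in_itv/= => /andP[ux xv]; apply: rU => /=.
      rewrite -ball_normE /= ltr_norml; apply/andP; split; lra.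
    - rewrite /= sP andbT; apply/allP => p /sI[]//.
    - rewrite big_cons/=.
      have : e * u <= e * v by rewrite ler_pM2l// ltW.
      lra.
  have [dphi Dphi] : derivable phi c 1 /\ 'D_1 phi c <= 0.
    apply: contrapT => nd; apply: Uc; apply: NU; apply: badN => /= h.
    by apply: nd; apply: h; rewrite in_itv/= ac.
  have [r r0 rphi] := derive_le0_increment dphi Dphi e0.
  exists r => // u v au cu uc cv vr vb [s [sI sP sS]].
  exists s; split => //.
    by move=> p /sI[? ? pu ?]; split => //; rewrite (le_trans pu)// (le_trans uc).
  have := rphi u v cu uc cv vr; lra.
case: Pb => s [sI sP sS].
rewrite (le_trans sS)// lerD2l ltW//.
pose u (k : 'I_(size s)) := (nth (0, 0) s k).1.
pose v (k : 'I_(size s)) := (nth (0, 0) s k).2.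
have suv k : [/\ a <= u k, u k < v k, v k <= b & `]u k, v k[ `<=` U].
  by apply: sI; rewrite mem_nth.
have tuv : trivIset setT (fun k => `]u k, v k[%classic).
  move=> i j _ _ [x []]; rewrite /= !in_itv/= => /andP[ui vi] /andP[uj vj].
  have sep (k l : 'I_(size s)) : (k < l)%N -> v l <= u k.
    by move=> kl; move/(pairwiseP (0, 0)) : sP => /(_ k l); apply; rewrite ?inE.
  apply: ord_inj; case: (ltngtP i j) => // /sep.
    by rewrite leNgt (lt_trans ui vj).
  by rewrite leNgt (lt_trans uj vi).
(* The charged intervals are disjoint and contained in [U], so their total length is below [d]. *)
rewrite (big_nth (0, 0)) big_mkord; apply: acd => //.
  by move=> k; case: (suv k).
rewrite -lte_fin -sumEFin; apply: le_lt_trans Ud.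
rewrite (eq_bigr (fun k => lebesgue_measure `]u k, v k[%classic)); last first.
  move=> k _; have [_ uvk _ _] := suv k.
  by rewrite lebesgue_measure_itv/= lte_fin uvk EFinB.
rewrite -measure_bigsetU_ord//.
apply: le_measure; rewrite ?inE//; first exact: bigsetU_measurable.
elim/big_ind : _ => // [A B AU BU|k _]; first by rewrite subUset.
by case: (suv k).
Qed.

(** * Contraction between two solutions *)

(** By [dotvBD] the difference quotient of the squared norm is the inner product of the quotient of
    [w] with [w (h + t) + w t], and the latter tends to twice [w t] by continuity. *)
Lemma derive_dotv_self (R : realType) (n : nat) (w : R -> 'rV[R]_n) (t : R) :
  derivable w t 1 ->
  is_derive t 1 (fun s => dotv (w s) (w s)) (2 * dotv ('D_1 w t) (w t)).
Proof.
move=> dw.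
have cw : w (h + t) @[h --> 0^'] --> w t.
  have /differentiable_continuous wt : differentiable w t.
    exact/derivable1_diffP.
  have ht : h + t @[h --> 0^'] --> t.
    rewrite -[X in _ --> X]add0r.
    by apply: cvgD; [exact: cvg_within|exact: cvg_cst].
  exact: (cvg_comp _ _ ht wt).
pose q (h : R) := h^-1 *: (dotv (w (h *: 1 + t)) (w (h *: 1 + t)) - dotv (w t) (w t)).
have qE : q = fun h => dotv (h^-1 *: (w (h *: 1 + t) - w t)) (w (h + t) + w t).
  apply/funext => h; rewrite /q dotvZl !scaler1; congr (_ * _).
  by rewrite dotvBD.
have quot : q @ 0^' --> 2 * dotv ('D_1 w t) (w t).
  rewrite qE; have := cvg_dotv dw (cvgD cw (cvg_cst (w t))).
  by rewrite -mulr2n -scaler_nat dotvZr; apply.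
apply: DeriveDef; first exact: (cvgP _ quot).
exact: (cvg_lim _ quot).
Qed.

(** Convexity of the exponential: after factoring out [expR (k * t)], this is [1 + y <= expR y] at
    [y = - (k * (t - s))]. *)
Lemma expR_increment (R : realType) (k s t : R) :
  expR (k * t) - expR (k * s) <= expR (k * t) * (k * (t - s)).
Proof.
have -> : k * s = k * t + - (k * (t - s)) by ring.
rewrite expRD -[X in X - _]mulr1 -mulrBr ler_wpM2l ?expR_ge0//.
have := expR_ge1Dx (- (k * (t - s))); lra.
Qed.

Lemma solution_le_contraction (R : realType) (n : nat)
    (f : R -> 'rV[R]_n -> 'rV[R]_n) (C : R -> set 'rV[R]_n) (M alpha : R) :
  0 < M -> (forall (t : R) (c : 'rV[R]_n), C t c -> enorm c <= M) ->
  0 < alpha ->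
  (forall (t : R) (x1 x2 : 'rV[R]_n),
    alpha * enorm (x1 - x2) ^+ 2 <= dotv (f t x1 - f t x2) (x1 - x2)) ->
  forall (t0 : R) (x1 x2 : R -> 'rV[R]_n),
    sweeping_solution f C `[t0, +oo[ x1 -> sweeping_solution f C `[t0, +oo[ x2 ->
    forall t, t0 <= t ->
      enorm (x1 t - x2 t) <= expR (- alpha * (t - t0)) * enorm (x1 t0 - x2 t0).
Proof.
move=> M0 CM al0 fmono t0 x1 x2 [ac1 C1 incl1] [ac2 C2 incl2] t t0t.
pose w s := x1 s - x2 s.
have wM s : t0 <= s -> enorm (w s) <= 2 * M.
  move=> ts; rewrite (le_trans (enormD _ _))// enormN mulr_natl mulr2n.
  by rewrite lerD// (CM s)//; [apply: C1|apply: C2]; rewrite in_itv/= ts.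
pose E s := expR (2 * alpha * s).
pose phi s := dotv (w s) (w s) * E s.
(* This transfers absolute continuity from [x1] and [x2] to [phi], in the one-sided form that
   [ac_derive_le0_le] asks for. The constants come from [enorm (w u) <= 2 * M] and [E v <= E t]. *)
have phi_le u v : t0 <= u -> u <= v -> v <= t ->
    phi v - phi u <= 4 * M * E t * (enorm (x1 v - x1 u) + enorm (x2 v - x2 u))
      + 8 * M ^+ 2 * alpha * E t * (v - u).
  move=> tu uv vt.
  have Ev : E v <= E t by rewrite ler_expR ler_pM2l// mulr_gt0.
  have Ev0 : 0 < E v by exact: expR_gt0.
  have -> : phi v - phi u = dotv (w v - w u) (w v + w u) * E v
      + dotv (w u) (w u) * (E v - E u).
    by rewrite /phi dotvBD; ring.
  apply: lerD.
    rewrite [leRHS](_ : _ = (enorm (x1 v - x1 u) + enorm (x2 v - x2 u)) *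
      (2 * M + 2 * M) * E t); last by ring.
    apply: (@le_trans _ _ (enorm (w v - w u) * enorm (w v + w u) * E v)).
      by rewrite ler_pM2r// dotv_le.
    rewrite ler_pM ?mulr_ge0 ?enorm_ge0 ?expR_ge0//.
    rewrite ler_pM ?enorm_ge0//.
      have -> : w v - w u = (x1 v - x1 u) - (x2 v - x2 u).
        by apply/rowP => i; rewrite !mxE; ring.
      by rewrite (le_trans (enormD _ _))// enormN.
    by rewrite (le_trans (enormD _ _))// lerD// wM// (le_trans tu).
  rewrite [leRHS](_ : _ = (2 * M) ^+ 2 * (E t * (2 * alpha * (v - u)))); last by ring.
  apply: (@le_trans _ _ (dotv (w u) (w u) * (E v * (2 * alpha * (v - u))))).
    by rewrite ler_wpM2l ?dotv_ge0// expR_increment.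
  have d0 : 0 <= 2 * alpha * (v - u) by rewrite mulr_ge0 ?subr_ge0// mulr_ge0// ltW.
  rewrite ler_pM ?dotv_ge0//; last by rewrite ler_wpM2r.
    by rewrite mulr_ge0// ltW.
  by rewrite -enorm_sqr ler_sqr ?nnegrE ?enorm_ge0 ?mulr_ge0 ?wM// ltW.
have : phi t <= phi t0.
  apply: ac_derive_le0_le => //.
    move=> e e0.
    have sub : `[t0, t] `<=` [set` `[t0, +oo[].
      by move=> s /=; rewrite !in_itv/= andbT => /andP[].
    pose B1 := 4 * M * E t; pose B2 := 8 * M ^+ 2 * alpha * E t.
    have Et0 : 0 < E t by exact: expR_gt0.
    have B10 : 0 < B1 by rewrite !mulr_gt0.
    have B20 : 0 < B2 by rewrite !mulr_gt0// exprn_gt0.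
    have e1 : 0 < e / (3 * B1) by rewrite divr_gt0// mulr_gt0.
    have e2 : 0 < e / (3 * B2) by rewrite divr_gt0// mulr_gt0.
    have [d1 d10 h1] := ac1 _ _ t0t sub _ e1.
    have [d2 d20 h2] := ac2 _ _ t0t sub _ e1.
    (* The contributions of [x1], of [x2] and of the exponential weight each get one third of
       [e]. *)
    exists (Num.min (Num.min d1 d2) (e / (3 * B2))); first by rewrite !lt_min d10 d20.
    move=> m u v uv tuv; rewrite !lt_min => /andP[/andP[l1 l2] l3].
    have {}h1 := h1 _ _ _ uv tuv l1; have {}h2 := h2 _ _ _ uv tuv l2.
    apply: (@le_lt_trans _ _ (\sum_(k < m) (B1 * (enorm (x1 (v k) - x1 (u k)) +
        enorm (x2 (v k) - x2 (u k))) + B2 * (v k - u k)))).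
      by apply: ler_sum => k _; have [? /ltW ? ?] := uv k; exact: phi_le.
    rewrite big_split/= -!mulr_sumr big_split/=.
    have -> : e = B1 * (e / (3 * B1) + e / (3 * B1)) + B2 * (e / (3 * B2)).
      by field; rewrite !gt_eqF.
    by rewrite ltrD// ltr_pM2l// ltrD.
  move: incl1 incl2; apply: filterS2.
    exact: (ae_filter_ringOfSetsType lebesgue_measure).
  move=> s h1 h2.
  rewrite in_itv/= => /andP[ts st].
  have sI : s \in `[t0, +oo[ by rewrite in_itv/= ts.
  have [dx1 [xi1 [_ N1] e1]] := h1 sI.
  have [dx2 [xi2 [_ N2] e2]] := h2 sI.
  have dw : derivable w s 1 by exact: derivableB.
  have Dw : 'D_1 w s = 'D_1 x1 s - 'D_1 x2 s by rewrite /w deriveB.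
  have dD := derive_dotv_self dw.
  have dE : is_derive s 1 E (2 * alpha * E s).
    by rewrite /E; apply: is_derive_eq; rewrite /GRing.scale/=; ring.
  have dphi : is_derive s 1 phi
      (dotv (w s) (w s) *: (2 * alpha * E s) + E s *: (2 * dotv ('D_1 w s) (w s))).
    exact: is_deriveM.
  split; first by case: dphi.
  rewrite (@derive_val _ _ _ _ _ _ _ dphi) /GRing.scale/=.
  have -> : dotv (w s) (w s) * (2 * alpha * E s) + E s * (2 * dotv ('D_1 w s) (w s))
      = 2 * E s * (dotv ('D_1 w s) (w s) + alpha * dotv (w s) (w s)) by ring.
  rewrite pmulr_rle0 ?mulr_gt0 ?expR_gt0//.
  (* Each normal vector is tested against the other solution, which lies in the same set [C s]; the
     two inequalities combine with the strong monotonicity of [f]. *)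
  have := N1 _ (C2 _ sI); have := N2 _ (C1 _ sI); have := fmono s (x1 s) (x2 s).
  have -> : 'D_1 w s = xi2 + f s (x2 s) - (xi1 + f s (x1 s)).
    by rewrite -e1 -e2 Dw opprK addrC.
  rewrite -[x2 s - x1 s]opprB -/(w s) enorm_sqr dotvNr !(dotvBl, dotvDl).
  lra.
rewrite /phi -!enorm_sqr => le_phi.
rewrite -ler_sqr ?nnegrE ?mulr_ge0 ?enorm_ge0 ?expR_ge0// exprMn.
rewrite -(ler_pM2r (expR_gt0 (2 * alpha * t))) (le_trans le_phi)//.
set X := enorm _ ^+ 2; set a := - alpha * _.
have -> : expR a ^+ 2 * X * expR (2 * alpha * t) =
    X * (expR a * expR a * expR (2 * alpha * t)) by ring.
by rewrite -!expRD ler_wpM2l ?sqr_ge0// ler_expR /a; lra.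
Qed.

(** * Almost everywhere differentiability of Lipschitz functions *)

Lemma stieltjes_itvoc (R : realType) (F : cumulative R R) (a b : R) : a <= b ->
  lebesgue_stieltjes_measure F `]a, b]%classic = (F b - F a)%:E.
Proof.
move=> ab; rewrite /lebesgue_stieltjes_measure /measure_extension/=.
by rewrite measurable_mu_extE/= ?wlength_itv_bnd//; exact: is_ocitv.
Qed.

Lemma continuous_cumulative (R : realType) (H : R -> R) :
  {homo H : x y / x <= y} -> continuous H ->
  exists F : cumulative R R, F = H :> (R -> R).
Proof.
move=> ndH cH.
pose F : cumulative R R := HB.pack H
  (isCumulative.Build R _ R H ndH (right_continuousW cH)).
by exists F.
Qed.

(* Adding a large linear term makes [g] monotone in both directions, so that the
   two Stieltjes measures add up to a multiple of Lebesgue measure. *)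
Lemma lipschitz_density (R : realType) (g : R -> R) (K : R) : 0 < K ->
  (forall x y, `|g x - g y| <= K * `|x - y|) ->
  exists2 F : cumulative R R, forall x, F x = K * x + g x &
    content_dominates (@lebesgue_measure R) (lebesgue_stieltjes_measure F).
Proof.
move=> K0 gK.
have cg : continuous g.
  move=> x; apply/cvgrPdist_le => e e0; near=> y.
  rewrite (le_trans (gK _ _))// mulrC -ler_pdivlMr//.
  near: y; apply: cvgr_dist_le; [exact: cvg_id|exact: divr_gt0].
have incr x y : x <= y -> `|g y - g x| <= K * (y - x).
  by move=> xy; rewrite -[y - x]ger0_norm ?subr_ge0.
have [F FE] : exists F : cumulative R R, F = (fun x => K * x + g x) :> (R -> R).
  apply: continuous_cumulative => [x y /incr|x].
    by rewrite ler_norml => /andP[]; lra.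
  by apply: cvgD (cg x); apply: cvgM; [exact: cvg_cst|exact: cvg_id].
have [G GE] : exists F : cumulative R R, F = (fun x => K * x - g x) :> (R -> R).
  apply: continuous_cumulative => [x y /incr|x].
    by rewrite ler_norml => /andP[]; lra.
  by apply: cvgB (cg x); apply: cvgM; [exact: cvg_cst|exact: cvg_id].
exists F => [x|]; first by rewrite FE.
(* [k] is [1 / (2 * K)], because [F] and [G] add up to the linear function of slope [2 * K]. *)
pose k : {nonneg R} := NngNum (ltW (divr_gt0 ltr01 (mulr_gt0 (ltr0Sn R 1) K0))).
pose nu := mscale k (measure_add (lebesgue_stieltjes_measure F)
                                 (lebesgue_stieltjes_measure G)).
have nu_add A : nu A = (k%:num%:E * (lebesgue_stieltjes_measure F A +
    lebesgue_stieltjes_measure G A))%E.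
  by rewrite /nu /mscale; congr (_ * _)%E; exact: measure_addE.
have nuE A : measurable A -> lebesgue_measure A = nu A.
  move=> mA; apply: lebesgue_stieltjes_measure_unique mA => X /ocitvP[->|].
    by rewrite !measure0.
  move=> [[a b] /= /ltW ab ->]; rewrite [RHS]nu_add !stieltjes_itvoc// FE GE.
  by rewrite -EFinD -EFinM; congr (_%:E) => /=; field; rewrite gt_eqF.
move=> A mA lA0; have := nuE _ mA; rewrite [LHS]lA0 nu_add.
move/esym/eqP; rewrite mule_eq0 => /orP[|].
  by rewrite eqe/= mul1r invr_eq0 mulf_eq0 pnatr_eq0/= gt_eqF.
by rewrite padde_eq0// => /andP[/eqP].
Unshelve. all: by end_near. Qed.

(** The Stieltjes measure of [F] is restricted to []a, b]] to make it finite, hence its density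
    integrable. The integral of the density is differentiable almost everywhere, and inside the
    interval it differs from [g] by an affine function. *)
Lemma lipschitz_derivable_ae_itv (R : realType) (g : R -> R) (K a b : R) : 0 < K ->
  (forall x y, `|g x - g y| <= K * `|x - y|) ->
  {ae lebesgue_measure, forall x : R, x \in `]a, b[ -> derivable g x 1}.
Proof.
move=> K0 gK; have [F FE dom] := lipschitz_density K0 gK.
have [ab|ba] := ltP a b; last first.
  apply: aeW => x; rewrite in_itv/= => /andP[ax xb].
  by have := lt_trans ax xb; rewrite ltNge ba.
have mab : measurable (`]a, b]%classic : set (measurableTypeR R)).
  exact: measurable_itv.
have fin : (lebesgue_stieltjes_measure F `]a, b]%classic < +oo)%E.
  by rewrite stieltjes_itvoc ?ltry// ltW.
pose nu : {finite_measure set (measurableTypeR R) -> \bar R} := mfrestr mab fin.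
have dom' : content_dominates (@lebesgue_measure R) (mfrestr mab fin).
  move=> A mA A0; rewrite /mfrestr /mrestr.
  apply: dom; first exact: measurableI.
  by apply: subset_measure0 A0 => //; exact: measurableI.
have /(@radon_nikodym_sigma_finite _ _ _ lebesgue_measure nu)
  [phi [_ phifin phiint phiE]] := (null_content_dominatesP _ _).2 dom'.
pose f := fine \o phi.
have fphi : EFin \o f = phi by apply/funext => x; rewrite /= fineK.
have fint y : lebesgue_measure.-integrable [set` Interval (BRight a) (BRight y)]
    (EFin \o f).
  by rewrite fphi; apply: integrableS phiint => //; exact: measurable_itv.
have floc : locally_integrable [set: R] f.
  by apply: open_integrable_locally; [exact: openT|rewrite fphi].
have := FTC1 fint floc; apply: filterS.
  exact: (ae_filter_ringOfSetsType lebesgue_measure).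
move=> x /= + xab; move: (xab); rewrite in_itv/= => /andP[ax xb].
move=> /(_ ax)[dx _].
have near_FE : \forall y \near x,
    (\int[lebesgue_measure]_(t in `]a, y]) f t)%R = K * y + g y - F a.
  near=> y.
  have /andP[ay yb] : a < y < b.
    by near: y; apply: near_in_itvoo.
  rewrite /Rintegral.
  have -> : (\int[lebesgue_measure]_(t in `]a, y]) (f t)%:E)%E =
      (\int[lebesgue_measure]_(t in `]a, y]) phi t)%E.
    by apply: eq_integral => t _; rewrite -fphi.
  rewrite -phiE; last exact: measurable_itv.
  have -> : nu `]a, y]%classic = lebesgue_stieltjes_measure F `]a, y]%classic.
    congr (lebesgue_stieltjes_measure F); apply: setIidl => t /=.
    by rewrite !in_itv/= => /andP[-> /le_trans]; apply; exact: ltW.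
  by rewrite stieltjes_itvoc ?ltW//= FE.
have := near_eq_derivable near_FE dx => dH.
have -> : g = (fun y => (K * y + g y - F a) - (K * y - F a)).
  by apply/funext => y; ring.
apply: derivableB dH _; apply: derivableB; last exact: derivable_cst.
by apply: derivableM; [exact: derivable_cst|exact: derivable_id].
Unshelve. all: by end_near. Qed.

(** Differentiability is local: on each []-N, N[] the function agrees with its composition with a
    clamp to [[-N, N]], whose coordinates are globally Lipschitz. Countably many intervals and
    finitely many coordinates still leave a null set. *)
Lemma locally_lipschitz_derivable_ae (R : realType) (n : nat) (x : R -> 'rV[R]_n) :
  (forall T : R, exists2 K, 0 < K & forall s t, -T <= s <= T -> -T <= t <= T ->
    enorm (x s - x t) <= K * `|s - t|) ->
  {ae lebesgue_measure, forall t : R, derivable x t 1}.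
Proof.
move=> lipx.
have aeFF := ae_filter_ringOfSetsType (@lebesgue_measure R).
have : {ae lebesgue_measure, forall t : R, forall (N : nat) (i : 'I_n),
    t \in `]- N%:R, N%:R[ -> derivable (fun s => x s 0 i) t 1}.
  apply: ae_foralln => N; apply: filter_forall => i.
  pose T : R := N%:R; have [K K0 Kx] := lipx T.
  have T0 : - T <= T by have := ler0n R N; rewrite -/T; lra.
  pose clamp s := Num.max (- T) (Num.min T s).
  have clampT s : - T <= clamp s <= T.
    by rewrite le_max lexx/= ge_max T0 ge_min lexx.
  have clamp_le s t : `|clamp s - clamp t| <= `|s - t|.
    wlog st : s t / s <= t => [h|].
      by have [/h//|/ltW /h] := leP s t; rewrite distrC [leRHS]distrC.
    rewrite distrC [leRHS]distrC [leRHS]ger0_norm ?subr_ge0// ler_norml /clamp.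
    rewrite !minEle !maxEle.
    by case: (leP T s) => ?; case: (leP T t) => ?;
      do ?[case: (leP (- T)) => ?]; apply/andP; split; lra.
  have gK s t : `|x (clamp s) 0 i - x (clamp t) 0 i| <= K * `|s - t|.
    apply: (@le_trans _ _ (enorm (x (clamp s) - x (clamp t)))).
      by have := normr_coord_le_enorm (x (clamp s) - x (clamp t)) i; rewrite !mxE.
    by rewrite (le_trans (Kx _ _ _ _))// ler_pM2l.
  have := lipschitz_derivable_ae_itv (- T) T K0 gK; apply: filterS => t /= dt tT.
  apply: near_eq_derivable (dt tT); near=> s.
  have /andP[Ts sT] : - T < s < T by near: s; exact: near_in_itvoo.
  by rewrite /clamp (min_idPr (ltW sT)) (max_idPr (ltW Ts)).
apply: filterS => t /= dt; apply/derivable_mxP => j i; rewrite ord1.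
have [N tN] : exists N : nat, `|t| < N%:R.
  by exists (Num.bound `|t|); exact: archi_boundP.
by apply: (dt N); rewrite in_itv/= -ltr_norml.
Unshelve. all: by end_near. Qed.

(** * Projection onto bounded closed convex sets *)

Section projection.
Context {R : realType} {n : nat}.
Implicit Types (A B : set 'rV[R]_n) (p q c : 'rV[R]_n).

(** The nearest point is encoded by its variational inequality, that is, by [p - q] being normal to
    [A] at [q]; the scheme uses this form directly. *)
Definition is_projection A p q :=
  A q /\ forall c, A c -> dotv (p - q) (c - q) <= 0.

(** Compactness gives a point [q] of least distance. If the inequality failed at [c], moving from
    [q] part of the way toward [c] would stay in [A] and come closer to [p]. *)
Lemma projection_exists A (M : R) p :
  A !=set0 -> closed A -> convex_set A -> (forall c, A c -> enorm c <= M) ->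
  exists q, is_projection A p q.
Proof.
move=> A0 clA cvxA AM.
have cA : compact A.
  exact: (@subclosed_compact _ A _ clA (@compact_enorm_ball R n M) AM).
have cdist : {within A, continuous (fun c => enorm (p - c))}.
  apply: continuous_subspaceT => c; apply: (@cvg_enorm _ _ _ (nbhs c)).
  by apply: cvgB; [exact: cvg_cst|exact: cvg_id].
have [q /set_mem Aq qmin] := EVT_min_rV A0 cA cdist.
exists q; split=> // c Ac; rewrite leNgt; apply/negP.
set d := dotv _ _ => d0; set N := dotv (c - q) (c - q).
have N0 : 0 <= N by exact: dotv_ge0.
have dN : 0 < d + N by rewrite ltr_wpDr.
(* Moving by the fraction [l] changes the squared distance by [l * (l * N - 2 * d)]; this [l] is at
   most 1 and makes [l * N < 2 * d]. *)
pose l := d / (d + N).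
have l0 : 0 < l by rewrite divr_gt0.
have l1 : l <= 1 by rewrite ler_pdivrMr// mul1r lerDl.
have := cvxA c q (Itv01 (ltW l0) l1) (mem_set Ac) (mem_set Aq).
move=> /qmin; rewrite -ler_sqr ?nnegrE ?enorm_ge0// !enorm_sqr.
rewrite [conv _ _ _](_ : _ = l *: c + (1 - l) *: q)//.
have -> : p - (l *: c + (1 - l) *: q) = (p - q) - l *: (c - q).
  by apply/rowP => i; rewrite !mxE; ring.
rewrite [leRHS]dotvBB !(dotvZl, dotvZr) -/d -/N.
suff : l * (l * N) < l * (2 * d) by lra.
rewrite ltr_pM2l// /l mulrAC ltr_pdivrMr//.
have : 0 < d * d by rewrite mulr_gt0.
have : 0 <= d * N by rewrite mulr_ge0// ltW.
lra.
Qed.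

Lemma projection_le A p q c : is_projection A p q -> A c ->
  enorm (p - q) <= enorm (p - c).
Proof.
move=> [_ vi] /vi pqc; rewrite -ler_sqr ?nnegrE ?enorm_ge0// !enorm_sqr.
have -> : p - c = (p - q) - (c - q) by rewrite opprB addrA subrK.
rewrite [leRHS]dotvBB.
have := dotv_ge0 (c - q); lra.
Qed.

Lemma hausdorff_projection_le A B (k : R) p q :
  (hausdorff_dist A B <= k%:E)%E -> B p -> is_projection A p q ->
  enorm (p - q) <= k.
Proof.
move=> + Bp pq; rewrite /hausdorff_dist ge_max => /andP[supBA _].
rewrite -lee_fin; apply: le_trans supBA.
apply: (@le_trans _ _ (edist_set p A)).
  by apply: le_ereal_inf_tmp => _ [c Ac <-]; rewrite lee_fin (projection_le pq).
by apply: ereal_sup_ubound; exists p.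
Qed.

End projection.

(** * The catching-up scheme and its limit along an ultrafilter *)

(** Compactness gives a cluster point. An ultrafilter contains the preimage of each neighbourhood or
    the complement of that preimage, and clustering rules out the complement. *)
Lemma compact_ultra_cvg {T : topologicalType} {I : Type} (F : set_system I)
    (A : set T) (u : I -> T) :
  UltraFilter F -> compact A -> (\forall i \near F, A (u i)) ->
  exists2 p, A p & u @ F --> p.
Proof.
move=> FU cA FA; have [p [Ap Fp]] := cA (u @ F) _ FA; exists p => // V pV.
have [//|FV] := in_ultra_setVsetC (u @^-1` V) FU.
by have [q [nVq Vq]] := Fp (~` V) V FV pV.
Qed.

Section catching_up.
Context {R : realType} {n : nat}.
Variables (f : R -> 'rV[R]_n -> 'rV[R]_n) (C : R -> set 'rV[R]_n).
Variables (Lf LC M : R) (P : R -> 'rV[R]_n -> 'rV[R]_n).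
Hypotheses (Lf_gt0 : 0 < Lf) (LC_gt0 : 0 < LC) (M_gt0 : 0 < M).
Hypothesis f_lip : forall (t1 t2 : R) (x1 x2 : 'rV[R]_n),
  enorm (f t1 x1 - f t2 x2) <= Lf * `|t1 - t2| + Lf * enorm (x1 - x2).
Hypothesis C_bounded : forall (t : R) (c : 'rV[R]_n), C t c -> enorm c <= M.
Hypothesis C_closed : forall t, closed (C t).
Hypothesis P_proj : forall t p, is_projection (C t) p (P t p).
Hypothesis P_dist : forall s t p, C s p -> enorm (p - P t p) <= LC * `|s - t|.

Definition field_bound (T : R) := enorm (f 0 0) + Lf * T + Lf * M.

(** A step is a projection residual of size at most [(LC + field_bound T) * h] plus a drift of size
    at most [field_bound T * h], hence the factor 2. *)
Definition speed_bound (T : R) := LC + 2 * field_bound T.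

(** The first product is the residual against the displacement of the test vector; the second is the
    cost of freezing [f] at step [i], with [2 * M] bounding the test vector. *)
Definition evi_bound (T : R) :=
  (LC + field_bound T) * (LC + speed_bound T) + Lf * (1 + speed_bound T) * (2 * M).

Lemma field_bound_ge0 T : 0 <= T -> 0 <= field_bound T.
Proof.
move=> T0; have l0 := ltW Lf_gt0; have m0 := ltW M_gt0.
by rewrite /field_bound !addr_ge0 ?enorm_ge0 ?mulr_ge0.
Qed.

Lemma speed_bound_gt0 T : 0 <= T -> 0 < speed_bound T.
Proof. by move=> T0; rewrite ltr_wpDr// mulr_ge0// field_bound_ge0. Qed.

Lemma evi_bound_ge0 T : 0 <= T -> 0 <= evi_bound T.
Proof.
move=> T0; have F0 := field_bound_ge0 T0; have K0 := ltW (speed_bound_gt0 T0).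
have L0 := ltW LC_gt0; have l0 := ltW Lf_gt0; have m0 := ltW M_gt0.
have LF0 : 0 <= LC + field_bound T by exact: addr_ge0.
have LK0 : 0 <= LC + speed_bound T by exact: addr_ge0.
have oK0 : 0 <= 1 + speed_bound T by exact: addr_ge0.
by rewrite addr_ge0// !mulr_ge0.
Qed.

Lemma field_le T t (x : 'rV[R]_n) : `|t| <= T -> enorm x <= M ->
  enorm (f t x) <= field_bound T.
Proof.
move=> tT xM; have := f_lip t 0 x 0; rewrite !subr0 => fl.
rewrite -[f t x](subrK (f 0 0)) (le_trans (enormD _ _))// /field_bound.
have : Lf * `|t| <= Lf * T by rewrite ler_pM2l.
have : Lf * enorm x <= Lf * M by rewrite ler_pM2l.
lra.
Qed.

Definition grid (h s0 : R) (k : nat) := s0 + k%:R * h.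

(** An explicit Euler step along [- f], then projection onto the next set. The start is the
    projection of the origin, an arbitrary choice of an element of [C s0]. *)
Fixpoint catch_up (h s0 : R) (k : nat) : 'rV[R]_n :=
  if k is k'.+1 then
    let x := catch_up h s0 k' in
    P (grid h s0 k) (x - h *: f (grid h s0 k') x)
  else P s0 0.

Section scheme.
Variables (h s0 : R).
Hypothesis h_gt0 : 0 < h.
Let s := grid h s0.
Let z := catch_up h s0.

Lemma gridS k : s k.+1 = s k + h.
Proof. by rewrite /s /grid -natr1; ring. Qed.

Lemma gridD i m : s (i + m) = s i + m%:R * h.
Proof. by rewrite /s /grid natrD; ring. Qed.

Lemma catch_up_in k : C (s k) (z k).
Proof.
case: k => [|k]; last exact: (P_proj _ _).1.
by rewrite /s /grid mul0r addr0; exact: (P_proj _ _).1.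
Qed.

Lemma catch_up_le k : enorm (z k) <= M.
Proof. exact: C_bounded (catch_up_in k). Qed.

(** The new iterate is at least as close to the drifted point as the projection of [z k] onto the
    next set is; reaching the latter costs [LC * h] for the motion of the set and
    [field_bound T * h] for the drift. *)
Lemma catch_up_residual T k : `|s k| <= T ->
  enorm (z k - h *: f (s k) (z k) - z k.+1) <= (LC + field_bound T) * h.
Proof.
move=> skT.
have [Pin _] := P_proj (s k.+1) (z k).
apply: (le_trans (projection_le (P_proj (s k.+1) _) Pin)).
rewrite -addrA [X in _ + X]addrC addrA (le_trans (enormD _ _))// mulrDl enormN.
rewrite lerD//.
  have := P_dist (s k.+1) (catch_up_in k).
  by rewrite gridS opprD addrA subrr sub0r normrN gtr0_norm.
by rewrite enormZ gtr0_norm// mulrC ler_pM2r// field_le// catch_up_le.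
Qed.

Lemma catch_up_step T k : `|s k| <= T ->
  enorm (z k.+1 - z k) <= speed_bound T * h.
Proof.
move=> skT; rewrite enormB.
have -> : z k - z k.+1 =
    (z k - h *: f (s k) (z k) - z k.+1) + h *: f (s k) (z k).
  by apply/rowP => i; rewrite !mxE; ring.
apply: (le_trans (enormD _ _)); rewrite enormZ gtr0_norm//.
have := catch_up_residual skT.
have : h * enorm (f (s k) (z k)) <= h * field_bound T.
  by rewrite ler_pM2l// field_le// catch_up_le.
rewrite /speed_bound; lra.
Qed.

Lemma catch_up_lipschitz T i m : - T <= s i -> s (i + m) <= T ->
  enorm (z (i + m) - z i) <= speed_bound T * (m%:R * h).
Proof.
move=> Ti; elim: m => [|m IH] smT.
  by rewrite addn0 subrr enorm0 mul0r mulr0.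
rewrite addnS gridS in smT *.
have smT' : s (i + m) <= T by rewrite (le_trans _ smT)// lerDl ltW.
have skT : `|s (i + m)| <= T.
  by rewrite ler_norml smT' andbT (le_trans Ti)// gridD lerDl mulr_ge0// ltW.
apply: (le_trans (enorm_triangle _ (z (i + m)) _)).
have := IH smT'; have := catch_up_step skT.
rewrite -natr1; lra.
Qed.

(* Summed projection inequalities: [c] is moved to each [C (s k)] at a cost
   proportional to [d], and so are the time and the state frozen at step [i]. *)
Lemma catch_up_evi T t0 c d i m : 0 <= T -> C t0 c ->
  - T <= s i -> s (i + m) <= T -> t0 - d <= s i -> s (i + m) <= t0 + d ->
  m%:R * h <= d ->
  dotv (z i - z (i + m) - (m%:R * h) *: f (s i) (z i)) (c - z i) <=
    evi_bound T * (m%:R * h) * d.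
Proof.
move=> T0 Cc Ti + di; elim: m => [|m IH] smT smd mhd.
  by rewrite addn0 subrr !mul0r mulr0 mul0r scale0r subr0 /dotv mul0mx mxE.
have K0 := ltW (speed_bound_gt0 T0); have F0 := field_bound_ge0 T0.
have h0 := ltW h_gt0.
have lt_sm : s (i + m) <= s (i + m.+1) by rewrite addnS gridS lerDl.
have smT' := le_trans lt_sm smT.
have mhd' : m%:R * h <= d by rewrite (le_trans _ mhd)// ler_pM2r// ler_nat.
have {}IH := IH smT' (le_trans lt_sm smd) mhd'.
have mh0 : 0 <= m%:R * h by rewrite mulr_ge0.
have d0 : 0 <= d by exact: le_trans mhd'.
have skT : `|s (i + m)| <= T.
  by rewrite ler_norml smT' andbT (le_trans Ti)// gridD lerDl.
set k := (i + m)%N in lt_sm smT' IH skT *.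
have kS : (i + m.+1 = k.+1)%N by rewrite addnS.
rewrite kS in smT smd lt_sm *.
(* The displacement due to the projection, normal to [C (s k.+1)] at [z k.+1], whence [vi] below. *)
pose w := z k - h *: f (s k) (z k) - z k.+1.
have wle : enorm w <= (LC + field_bound T) * h by exact: catch_up_residual.
pose c' := P (s k.+1) c.
have c'in : C (s k.+1) c' by exact: (P_proj _ _).1.
have cc' : enorm (c - c') <= LC * d.
  apply: (le_trans (P_dist _ Cc)); rewrite ler_pM2l// distrC ler_norml.
  have : s i <= s k.+1 by rewrite -kS gridD lerDl mulr_ge0.
  by move=> sik; apply/andP; split; lra.
have zz : enorm (z k.+1 - z i) <= speed_bound T * d.
  rewrite -kS; apply: (le_trans (catch_up_lipschitz Ti _)); first by rewrite kS.
  exact: ler_wpM2l.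
have zk : enorm (z k - z i) <= speed_bound T * d.
  by apply: (le_trans (catch_up_lipschitz Ti _)) => //; exact: ler_wpM2l.
have ff : enorm (f (s i) (z i) - f (s k) (z k)) <= Lf * (1 + speed_bound T) * d.
  apply: (le_trans (f_lip _ _ _ _)); rewrite -mulrDr -mulrA ler_pM2l//.
  rewrite mulrDl mul1r lerD//; last by rewrite enormB.
  by rewrite distrC /k gridD addrAC subrr add0r ger0_norm.
have cz : enorm (c - z i) <= 2 * M.
  rewrite (le_trans (enormD _ _))// enormN mulr_natl mulr2n.
  by rewrite lerD ?catch_up_le ?(C_bounded Cc).
have vi : dotv w (c' - z k.+1) <= 0 by exact: (P_proj _ _).2.
have -> : z i - z k.+1 - (m.+1%:R * h) *: f (s i) (z i) =
    (z i - z k - (m%:R * h) *: f (s i) (z i)) +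
    (w - h *: (f (s i) (z i) - f (s k) (z k))).
  by apply/rowP => j; rewrite !mxE -natr1; ring.
rewrite dotvDl [X in _ + X]dotvBl dotvZl.
(* The first summand has a sign by [vi]; in the second the vector paired with [w] is of order [d]
   and [w] is of order [h]. *)
have -> : dotv w (c - z i) =
    dotv w (c' - z k.+1) + dotv w ((c - c') + (z k.+1 - z i)).
  by rewrite -dotvDr; congr dotv; apply/rowP => j; rewrite !mxE; ring.
have b1 : dotv w ((c - c') + (z k.+1 - z i)) <=
    (LC + field_bound T) * h * ((LC + speed_bound T) * d).
  apply: (le_trans (dotv_le _ _)); rewrite ler_pM ?enorm_ge0//.
  by rewrite (le_trans (enormD _ _))// mulrDl lerD.
have b2 : - dotv (f (s i) (z i) - f (s k) (z k)) (c - z i) <=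
    Lf * (1 + speed_bound T) * d * (2 * M).
  rewrite -dotvNl; apply: (le_trans (dotv_le _ _)).
  by rewrite enormN ler_pM ?enorm_ge0.
have b3 : h * - dotv (f (s i) (z i) - f (s k) (z k)) (c - z i) <=
    h * (Lf * (1 + speed_bound T) * d * (2 * M)) by rewrite ler_pM2l.
have -> : evi_bound T * (m.+1%:R * h) * d = evi_bound T * (m%:R * h) * d +
    ((LC + field_bound T) * h * ((LC + speed_bound T) * d) +
    h * (Lf * (1 + speed_bound T) * d * (2 * M))).
  by rewrite -natr1 /evi_bound; ring.
lra.
Qed.

End scheme.

(** The inclusion in a form free of derivatives: the last clause is the continuous counterpart of
    [catch_up_evi], where [B] may depend on [t] but not on [d] or [c]. *)
Definition limit_solution (x : R -> 'rV[R]_n) :=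
  [/\ forall t, C t (x t),
      forall T, exists2 K, 0 < K & forall s t, - T <= s <= T -> - T <= t <= T ->
        enorm (x s - x t) <= K * `|s - t| &
      forall t, exists B, forall d c, 0 < d -> d <= 1 -> C t c ->
        dotv (x t - x (t + d) - d *: f t (x t)) (c - x t) <= B * d ^+ 2].

(* The scheme is started at time [-N] with step [1 / (N + 1)]; since all iterates
   stay in a fixed ball, a pointwise limit along an ultrafilter exists for free. *)
Lemma limit_solution_exists : exists x, limit_solution x.
Proof.
have [U [UU oU]] := ultraFilterLemma eventually_filter.
have PU : ProperFilter U by exact: ultra_proper.
pose h N : R := N.+1%:R^-1.
(* Once [- N <= t], this is the index of the last grid time not after [t]; the factor [N.+1] is the
   inverse of the step. *)
pose idx N t := Num.trunc ((t + N%:R) * N.+1%:R : R).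
pose X N t := catch_up (h N) (- N%:R) (idx N t).
pose S N t := grid (h N) (- N%:R) (idx N t).
have h0 N : 0 < h N by rewrite invr_gt0.
have h1 N : h N <= 1 by rewrite invf_le1// ler1n.
have hU : h @ U --> (0 : R) by move=> A /cvg_harmonic /oU.
have largeU (r : R) : \forall N \near U, r <= N%:R by apply: oU; exact: nbhs_infty_ger.
have SX N t : C (S N t) (X N t) by exact: catch_up_in.
have S_itv N t : - t <= N%:R -> S N t <= t < S N t + h N.
  move=> tN; have N0 : 0 < N.+1%:R :> R by [].
  have /truncn_itv : 0 <= (t + N%:R) * N.+1%:R by rewrite mulr_ge0//; lra.
  rewrite -/(idx N t) -[(idx N t).+1%:R]natr1 -ler_pdivrMr// -ltr_pdivlMr//.
  rewrite mulrDl mul1r /S /grid -/(h N) => /andP[? ?]; apply/andP; split; lra.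
have idxS N s t : s <= t ->
    exists m, idx N t = (idx N s + m)%N /\ m%:R * h N = S N t - S N s.
  move=> st; exists (idx N t - idx N s)%N.
  have /subnKC stE : (idx N s <= idx N t)%N by rewrite le_truncn// ler_wpM2r// lerD2r.
  by split; [rewrite stE|rewrite /S -[in RHS]stE gridD addrAC subrr add0r].
have SU t : S N t @[N --> U] --> t.
  have lo : t - h N @[N --> U] --> t.
    by rewrite -[X in _ --> X]subr0; apply: cvgB hU; exact: cvg_cst.
  apply: (squeeze_cvgr _ lo (cvg_cst t)); near=> N.
  have /andP[? ?] : S N t <= t < S N t + h N by apply: S_itv; near: N; exact: largeU.
  by apply/andP; split; lra.
have XM t : exists2 p, enorm p <= M & X N t @[N --> U] --> p.
  apply: (compact_ultra_cvg UU (@compact_enorm_ball R n M)).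
  by apply: nearW => N; exact: C_bounded (SX N t).
pose x t := sval (cid2 (XM t)).
have XU t : X N t @[N --> U] --> x t by rewrite /x; case: cid2.
have near_itv t : \forall N \near U, S N t <= t < S N t + h N.
  by near=> N; apply: S_itv; near: N; exact: largeU.
have SU0 t : `|S N t - t| @[N --> U] --> (0 : R).
  by have := cvg_norm (cvgB (SU t) (cvg_cst t)); rewrite subrr normr0; apply.
have XU0 t : enorm (X N t - x t) @[N --> U] --> (0 : R).
  by have := cvg_enorm (cvgB (XU t) (cvg_cst (x t))); rewrite subrr enorm0; apply.
exists x; split.
- move=> t.
  (* [X N t] lies in [C (S N t)], not necessarily in [C t]; its projection onto the closed set [C t]
     has the same limit. *)
  have Pt : P t (X N t) @[N --> U] --> x t.
    apply: enorm_cvg0.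
    have dist0 : LC * `|S N t - t| + enorm (X N t - x t) @[N --> U] --> (0 : R).
      rewrite -[X in _ --> X]addr0 -{1}(mulr0 LC); apply: cvgD.
        by apply: cvgM (SU0 t); exact: cvg_cst.
      exact: XU0.
    apply: (squeeze_cvgr _ (cvg_cst 0) dist0); apply: nearW => N.
    rewrite enorm_ge0/= (le_trans (enorm_triangle _ (X N t) _))// lerD2r.
    by rewrite enormB P_dist.
  have Pin : \forall N \near U, C t (P t (X N t)).
    by apply: nearW => N; exact: (P_proj _ _).1.
  exact: (@closed_cvg _ _ U _ _ (C t) (@C_closed t) Pin (x t) Pt).
- move=> T; have T0 : 0 <= `|T| + 1 by rewrite addr_ge0.
  (* Grid times lag by less than [h N <= 1], hence the extra 1; the absolute value covers negative
     [T]. *)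
  exists (speed_bound (`|T| + 1)); first exact: speed_bound_gt0.
  move=> s t; wlog st : s t / s <= t => [wl sT tT|].
    by have [/wl|/ltW /wl] := leP s t; [exact|rewrite enormB distrC; exact].
  move=> /andP[Ts _] /andP[_ tT].
  rewrite enormB distrC [`|t - s|]ger0_norm ?subr_ge0//.
  have lhs : enorm (X N t - X N s) @[N --> U] --> enorm (x t - x s).
    exact: (cvg_enorm (cvgB (XU t) (XU s))).
  have rhs : speed_bound (`|T| + 1) * (S N t - S N s) @[N --> U] -->
      speed_bound (`|T| + 1) * (t - s).
    by apply: cvgM; [exact: cvg_cst|apply: cvgB; exact: SU].
  apply: (ler_cvg_to lhs rhs); near=> N.
  have /andP[? ?] : S N s <= s < S N s + h N by near: N; exact: near_itv.
  have /andP[? ?] : S N t <= t < S N t + h N by near: N; exact: near_itv.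
  have := h1 N; have := ler_norm T.
  have [m [tE <-]] := idxS N s t st => ? ?.
  rewrite /X tE; apply: catch_up_lipschitz => //; first by rewrite -/(S N s); lra.
  by rewrite -tE -/(S N t); lra.
(* The slack 2 leaves room for [d <= 1] and for the grid lag. *)
- move=> t; pose T := `|t| + 2; have T0 : 0 <= T by rewrite addr_ge0.
  exists (evi_bound T) => d c d0 d1 Cc.
  have fU : f (S N t) (X N t) @[N --> U] --> f t (x t).
    apply: enorm_cvg0.
    have dist0 : Lf * `|S N t - t| + Lf * enorm (X N t - x t) @[N --> U] --> (0 : R).
      rewrite -[X in _ --> X]addr0 -{1 2}(mulr0 Lf); apply: cvgD.
        by apply: cvgM (SU0 t); exact: cvg_cst.
      by apply: cvgM (XU0 t); exact: cvg_cst.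
    apply: (squeeze_cvgr _ (cvg_cst 0) dist0); apply: nearW => N.
    by rewrite enorm_ge0/= f_lip.
  have lhs : dotv (X N t - X N (t + d) - (S N (t + d) - S N t) *: f (S N t) (X N t))
      (c - X N t) @[N --> U] -->
      dotv (x t - x (t + d) - (t + d - t) *: f t (x t)) (c - x t).
    apply: cvg_dotv; last by apply: cvgB; [exact: cvg_cst|exact: XU].
    apply: cvgB; first by apply: cvgB; exact: XU.
    by apply: cvgZ fU; apply: cvgB; exact: SU.
  (* The grid times used lie within [d + h N] of [t] and differ by at most [d + h N]; the excess
     [h N] vanishes in the limit. *)
  have rhs : evi_bound T * ((d + h N) * (d + h N)) @[N --> U] -->
      evi_bound T * ((d + 0) * (d + 0)).
    apply: cvgM; first exact: cvg_cst.
    by apply: cvgM; apply: cvgD => //; exact: cvg_cst.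
  have tdE : t + d - t = d by ring.
  rewrite tdE in lhs; rewrite addr0 -expr2 in rhs.
  apply: (ler_cvg_to lhs rhs); near=> N.
  have /andP[? ?] : S N t <= t < S N t + h N by near: N; exact: near_itv.
  have /andP[? ?] : S N (t + d) <= t + d < S N (t + d) + h N.
    by near: N; exact: near_itv.
  have := h1 N; have := h0 N; have := ler_norm t; have := ler_norm (- t).
  rewrite normrN => ? ? hN0 hN1.
  have [|m [tE mE]] := idxS N t (t + d); first by rewrite lerDl ltW.
  have mdh : m%:R * h N <= d + h N by rewrite mE; lra.
  apply: (@le_trans _ _ (evi_bound T * (m%:R * h N) * (d + h N))).
    rewrite -mE {2}/X tE; apply: (@catch_up_evi _ _ hN0 T t) => //.
    + by rewrite -/(S N t) /T; lra.
    + by rewrite -tE -/(S N (t + d)) /T; lra.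
    + by rewrite -/(S N t); lra.
    + by rewrite -tE -/(S N (t + d)); lra.
  rewrite [leRHS]mulrA ler_wpM2r//; first by rewrite addr_ge0// ltW.
  by rewrite ler_wpM2l// evi_bound_ge0.
Unshelve. all: by end_near. Qed.

End catching_up.

(** * Restriction of solutions, and the inclusion for the limit *)

Lemma sweeping_solutionS (R : realType) (n : nat) (f : R -> 'rV[R]_n -> 'rV[R]_n)
    (C : R -> set 'rV[R]_n) (I J : interval R) (x : R -> 'rV[R]_n) :
  [set` J] `<=` [set` I] -> sweeping_solution f C I x -> sweeping_solution f C J x.
Proof.
move=> JI [acx Cx inclx]; split.
- by move=> a b ab abJ; apply: acx => //; exact: subset_trans JI.
- by move=> t tJ; exact: Cx (JI _ tJ).
- move: inclx; apply: filterS.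
    exact: (ae_filter_ringOfSetsType lebesgue_measure).
  by move=> t /= incl tJ; exact: incl (JI _ tJ).
Qed.

(* Dividing the quadratic inequality of [limit_solution] by the time increment
   shows that the inclusion holds at every point of differentiability. *)
Lemma limit_solution_sweeping (R : realType) (n : nat)
    (f : R -> 'rV[R]_n -> 'rV[R]_n) (C : R -> set 'rV[R]_n) (x : R -> 'rV[R]_n) :
  limit_solution f C x -> sweeping_solution f C `]-oo, +oo[ x.
Proof.
move=> [Cx lipx evix]; split => [a b ab _ e e0||].
- have [K K0 Kx] := lipx (`|a| + `|b|).
  exists (e / K); first by rewrite divr_gt0.
  move=> m u v uv _ duv.
  have inT s : a <= s <= b -> - (`|a| + `|b|) <= s <= `|a| + `|b|.
    have := ler_norm (- a); have := ler_norm b; have := normr_ge0 a.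
    have := normr_ge0 b; rewrite normrN => ? ? ? ? /andP[? ?].
    by apply/andP; split; lra.
  apply: (@le_lt_trans _ _ (\sum_(k < m) K * (v k - u k))).
    apply: ler_sum => k _; have [auk ukvk vkb] := uv k.
    rewrite -[v k - u k]gtr0_norm ?subr_gt0//; apply: Kx; apply: inT.
      by rewrite vkb (le_trans auk)// ltW.
    by rewrite auk (le_trans (ltW ukvk)).
  by rewrite -mulr_sumr mulrC -ltr_pdivlMr.
- by move=> t _; exact: Cx.
- have := locally_lipschitz_derivable_ae lipx; apply: filterS.
    exact: (ae_filter_ringOfSetsType lebesgue_measure).
  move=> t /= dx _; split=> //.
  exists (- 'D_1 x t - f t (x t)); last by rewrite subrK.
  split=> // c Cc; have [B Bx] := evix t.
  (* Right-hand quotients are taken because the quadratic inequality concerns positive increments;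
     they converge to the derivative since [x] is differentiable at [t]. *)
  have lhs : dotv (- (h^-1 *: (x (h *: 1 + t) - x t)) - f t (x t)) (c - x t)
      @[h --> 0^'+] --> dotv (- 'D_1 x t - f t (x t)) (c - x t).
    apply: cvg_dotv; last exact: cvg_cst.
    apply: cvgB; last exact: cvg_cst.
    by apply: cvgN; apply: cvg_dnbhs_at_right; exact: dx.
  have rhs : B * h @[h --> (0 : R)^'+] --> B * 0.
    apply: cvgM; first exact: cvg_cst.
    exact: cvg_within.
  rewrite -(mulr0 B); apply: (ler_cvg_to lhs rhs); near=> h.
  have h0 : 0 < h by near: h; exact: nbhs_right_gt.
  have h1 : h <= 1 by near: h; exact: nbhs_right_le.
  rewrite -(ler_pM2l h0) -dotvZl mulrCA -expr2.
  apply: le_trans (Bx _ _ h0 h1 Cc); rewrite le_eqVlt; apply/orP; left.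
  apply/eqP; congr dotv; rewrite scaler1 [h + t]addrC.
  by apply/rowP => i; rewrite !mxE; field; rewrite gt_eqF.
Unshelve. all: by end_near. Qed.

Theorem theorem2p2 (R : realType) (n : nat)
    (f : R -> 'rV[R]_n -> 'rV[R]_n) (Lf : R)
    (Lf_gt0 : 0 < Lf)
    (f_lip : forall (t1 t2 : R) (x1 x2 : 'rV[R]_n),
       enorm (f t1 x1 - f t2 x2) <= Lf * `|t1 - t2| + Lf * enorm (x1 - x2))
    (C : R -> set 'rV[R]_n)
    (C_neq0 : forall t : R, C t !=set0)
    (C_closed : forall t : R, closed (C t))
    (C_convex : forall t : R, convex_set (C t))
    (LC : R) (LC_gt0 : 0 < LC)
    (C_lip : forall t1 t2 : R,
       (hausdorff_dist (C t1) (C t2) <= (LC * `|t1 - t2|)%:E)%E)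
    (M : R) (M_gt0 : 0 < M)
    (C_bounded : forall (t : R) (c : 'rV[R]_n), C t c -> enorm c <= M)
    (alpha : R) (alpha_gt0 : 0 < alpha)
    (f_mono : forall (t : R) (x1 x2 : 'rV[R]_n),
       alpha * enorm (x1 - x2) ^+ 2 <= dotv (f t x1 - f t x2) (x1 - x2)) :
  incrementally_stable f C /\
  exists x0 : R -> 'rV[R]_n,
    [/\ sweeping_solution f C `]-oo, +oo[ x0,
        forall y : R -> 'rV[R]_n,
          sweeping_solution f C `]-oo, +oo[ y -> y = x0 &
        globally_exponentially_stable f C x0].
Proof.
have contraction := solution_le_contraction M_gt0 C_bounded alpha_gt0 f_mono.
(* Used twice: for the decay of [beta] in time and, with [r = 2 * M], for uniqueness. *)
have decay r : expR (- alpha * s) * r @[s --> +oo] --> (0 : R).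
  rewrite -[X in _ --> X](mul0r r); apply: cvgM; last exact: cvg_cst.
  have alpha_y : alpha * s @[s --> +oo] --> +oo.
    apply/cvgryPge => A; have := nbhs_pinfty_ge (num_real (A / alpha)).
    by apply: filterS => s; rewrite ler_pdivrMr// mulrC.
  have -> : (fun s => expR (- alpha * s)) = (fun y => expR (- y)) \o *%R alpha.
    by apply/funext => s /=; rewrite mulNr.
  exact: (cvg_comp _ _ alpha_y (@cvgr_expR R)).
split.
  exists (fun r s => expR (- alpha * s) * r); split.
  - by move=> r s r0 s0; rewrite mulr_ge0 ?expR_ge0.
  - move=> s s0; split; last by rewrite mulr0.
      apply: continuous_subspaceT => r; apply: cvgM; first exact: cvg_cst.
      exact: cvg_id.
    by move=> r1 r2 _ _ r12; rewrite ltr_pM2l ?expR_gt0.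
  - move=> r r0; split; last exact: decay.
    move=> s1 s2 _ _ s12; rewrite ler_wpM2r// ler_expR !mulNr lerN2.
    by rewrite ler_pM2l.
  - by move=> t0 x1 x2 sx1 sx2 t t0t; exact: contraction.
have projs t p : exists q, is_projection (C t) p q.
  exact: projection_exists (C_neq0 t) (C_closed t) (C_convex t) (C_bounded t).
pose P t p := sval (cid (projs t p)).
have P_proj t p : is_projection (C t) p (P t p) by rewrite /P; case: cid.
have P_dist s t p : C s p -> enorm (p - P t p) <= LC * `|s - t|.
  move=> Csp; rewrite distrC.
  exact: (hausdorff_projection_le (C_lip t s) Csp (P_proj t p)).
have [x0 /limit_solution_sweeping sx0] := limit_solution_exists Lf_gt0 LC_gt0
  M_gt0 f_lip C_bounded C_closed P_proj P_dist.
have restr t y : sweeping_solution f C `]-oo, +oo[ y ->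
    sweeping_solution f C `[t, +oo[ y.
  by apply: sweeping_solutionS => s _; rewrite /= in_itv.
exists x0; split=> //.
- move=> y sy; apply/funext => t; apply/eqP; rewrite -subr_eq0; apply/eqP.
  apply: enorm0_eq0; apply/eqP; rewrite eq_le enorm_ge0 andbT.
  (* The contraction is started at time [t - s], where the two solutions are at most [2 * M] apart;
     letting [s] grow forces equality at [t]. *)
  have le_decay s : 0 <= s ->
      enorm (y t - x0 t) <= expR (- alpha * s) * (2 * M).
    move=> s0; have := contraction _ _ _ (restr (t - s) _ sy) (restr _ _ sx0) t.
    rewrite gerBl subKr => /(_ s0) /le_trans; apply.
    rewrite ler_wpM2l ?expR_ge0// (le_trans (enormD _ _))// enormN.
    have [_ Cy _] := sy; have [_ Cx0 _] := sx0.
    by rewrite mulr_natl mulr2n lerD// (C_bounded (t - s))//; [exact: Cy|exact: Cx0].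
  apply: (ler_cvg_to (cvg_cst _) (decay (2 * M))); near=> s; apply: le_decay.
  by near: s; apply: nbhs_pinfty_ge; rewrite num_real.
- exists 1, alpha; split=> // tau v sv t taut.
  by rewrite mul1r; exact: contraction sv (restr _ _ sx0) _ taut.
Unshelve. all: by end_near. Qed.
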